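(* Let $\tilde F_n(x)$, $n=1,2,\dots$, be the sequence of functions defined for $x>0$ as follows. (i) $\tilde F_n(x)=x$ for $0<x\le1$ and all $n$; moreover $\tilde F_1(x)=x$ for all $x>0$. (ii) For $x>1$ and $n\ge2$, $$\tilde F_n(x)=\min_{0<y<x-1}\left(\tilde F_{n-1}(y)+\frac{x}{y+1}\right).$$ Define also the function $\tilde F(x)$, $x>0$, as follows. (i$'$) If $0<x\le1$, then $\tilde F(x)=x$. (ii$'$) In the intervals $(1,2],(2,3],\dots$ the values $\tilde F(x)$ are defined recursively by means of the functional equation $$\tilde F(x)=\min_{0<y<x-1}\left(\tilde F(y)+\frac{x}{y+1}\right)$$ (for $x\in(k,k+1]$, $k=1,2,\dots$, the right-hand side involves only the values $\tilde F(y)$ with $0<y<x-1\le k$, so the values of $\tilde F$ on $(0,k]$ determine those on $(k,k+1]$, starting from $\tilde F(x)=x$ on $(0,1]$). Then: (a) $\tilde F(x)=\tilde F_n(x)$ for $0<x\le n$; (b) $\tilde F_n(x)=F_n(x)$ for all $n$ and $x$; and (c) $\tilde F(x)=F(x)$ for all $x$.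
   Context: For $n\in\mathbb N=\{1,2,\dots\}$ and $x>0$, $$F_n(x)=\inf_{t_1,\dots,t_{n-1}\ge 0}\left(t_1+\frac{t_2}{t_1+1}+\dots+\frac{t_{n-1}}{t_{n-2}+1}+\frac{x}{t_{n-1}+1}\right),$$ that is, the infimum of $t_1+\sum_{j=2}^n \frac{t_j}{t_{j-1}+1}$ over $t_1,\dots,t_{n-1}\ge 0$ with $t_n=x$ (so $F_1(x)=x$), and $F(x)=\inf_{n\in\mathbb N}F_n(x)$. Part of the assertion is that the minima in the recursive definitions are attained. *)

(* Defs.v *)
From HB Require Import structures.
From mathcomp Require Import all_boot all_order all_algebra.
From mathcomp Require Import all_classical all_reals.

Set Implicit Arguments.
Unset Strict Implicit.
Unset Printing Implicit Defensive.

Import Order.TTheory GRing.Theory Num.Theory.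

Local Open Scope classical_set_scope.
Local Open Scope ring_scope.

(* The variables t_1, ..., t_n are the values t 1, ..., t n of a map
   t : nat -> R; its other values play no role when 1 <= n. *)
Definition cost (R : realType) (n : nat) (t : nat -> R) : R :=
  t 1%N + \sum_(2 <= j < n.+1) t j / (t j.-1 + 1).

Definition admissible (R : realType) (n : nat) (x : R) : set (nat -> R) :=
  [set t | (forall j, (1 <= j < n)%N -> 0 <= t j) /\ t n = x].

(* Meaningful for 1 <= n and 0 < x only.  The reals [inf] is then a genuine
   infimum: the set of costs is nonempty and bounded below by 0. *)
Definition Fn (R : realType) (n : nat) (x : R) : R :=
  inf [set cost n t | t in admissible n x].

Definition Finf (R : realType) (x : R) : R :=
  inf [set Fn n x | n in [set n | (1 <= n)%N]].

Definition is_min (R : realType) (A : set R) (m : R) : Prop :=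
  A m /\ lbound A m.

Definition step_values (R : realType) (f : R -> R) (x : R) : set R :=
  [set f y + x / (y + 1) | y in [set y | 0 < y < x - 1]].

(* The functions live on (0, +oo), so values at x <= 0, and the member of index
   0 of the sequence, are left unconstrained.  On x > 0 the clauses below
   determine the functions completely; since [is_min] asks for attainment,
   existence of such functions means that all the minima are attained. *)
Definition is_tildeFn (R : realType) (G : nat -> R -> R) : Prop :=
  [/\ forall n x, (1 <= n)%N -> 0 < x <= 1 -> G n x = x,
      forall x, 0 < x -> G 1%N x = x &
      forall n x, (2 <= n)%N -> 1 < x -> is_min (step_values (G n.-1) x) (G n x)].

Definition is_tildeF (R : realType) (H : R -> R) : Prop :=
  (forall x, 0 < x <= 1 -> H x = x) /\
  (forall k x, (1 <= k)%N -> k%:R < x <= k.+1%:R ->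
     is_min (step_values H x) (H x)).

(* Main.v *)
(* [F_n] is the infimum over all y >= 0 of F_(n-1)(y) + x / (y + 1), is
   1-Lipschitz, and decreases with n.  The minimum over the compact interval
   [0, x - 1] therefore exists; what remains is that every y outside
   ]0, x - 1[ is beaten by some point inside.  By induction write
   F_(n-1)(y) = F_(n-2)(z) + y / (z + 1).  If z + 1 < x, then
   y / (z + 1) + x / (y + 1) is smallest at y = sqrt (x (z + 1)) - 1, which is
   inside.  If z + 1 >= x, then y is superfluous: the chain ending in z, x is at
   least as cheap as the one ending in z, y, x, and its cost is at least
   F_(n-1)(x), where the induction hypothesis supplies a point inside. *)
Require Import Defs.
From HB Require Import structures.
From mathcomp Require Import all_boot all_order all_algebra.
From mathcomp Require Import all_classical all_reals.
From mathcomp Require Import topology normedtype derive.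
From mathcomp Require Import ring lra.

Set Implicit Arguments.
Unset Strict Implicit.
Unset Printing Implicit Defensive.

Import Order.TTheory GRing.Theory Num.Theory.
Import numFieldNormedType.Exports.

Local Open Scope classical_set_scope.
Local Open Scope ring_scope.

(** * Minima of Lipschitz functions and a two-term inequality *)

Lemma lipschitz_min (R : realType) (f : R -> R) (a b k : R) :
  a <= b -> 0 < k ->
  (forall x y, a <= x -> x <= y -> y <= b -> `|f x - f y| <= k * (y - x)) ->
  exists2 c, a <= c <= b & forall x, a <= x <= b -> f c <= f x.
Proof.
move=> ab k0 fL.
suff /(EVT_min ab)[c cab cP] : {within `[a, b], continuous f}.
  by exists c => [|x xab]; [move: cab | apply: cP]; rewrite in_itv.
apply/subspace_continuousP => x; rewrite /= in_itv /= => /andP[ax xb].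
apply/cvgrPdist_le => e e0; rewrite near_withinE; near=> y.
rewrite /= in_itv /= => /andP[ay yb].
have xy : `|x - y| <= e / k.
  by near: y; apply: cvgr_dist_le; [exact: cvg_id | rewrite divr_gt0].
rewrite ler_pdivlMr // mulrC in xy; apply: le_trans xy.
have [le_xy|/ltW le_yx] := leP x y.
  by rewrite (distrC x) (ger0_norm (_ : 0 <= y - x)) ?subr_ge0 // fL.
by rewrite distrC (ger0_norm (_ : 0 <= x - y)) ?subr_ge0 // fL.
Unshelve. all: by end_near.
Qed.

(** AM-GM with equality at [u = s]: the right side minus the left is [(u - s) ^+ 2 / (a * u)]. *)
Lemma ler_sqrt_sum (R : realFieldType) (x a u s : R) :
  0 < a -> 0 < u -> 0 < s -> s ^+ 2 = x * a -> s / a + x / s <= u / a + x / u.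
Proof.
move=> a0 u0 s0 sE.
have -> : x = s ^+ 2 / a by rewrite sE mulfK ?gt_eqF.
rewrite -subr_ge0.
have -> : u / a + s ^+ 2 / a / u - (s / a + s ^+ 2 / a / s)
          = (u - s) ^+ 2 / (a * u).
  by field; rewrite !gt_eqF.
by rewrite divr_ge0 ?sqr_ge0 // ltW // mulr_gt0.
Qed.

Lemma is_min_unique (R : realType) (A : set R) (m m' : R) :
  is_min A m -> is_min A m' -> m = m'.
Proof. by move=> [Am mA] [Am' m'A]; apply/le_anti; rewrite mA ?m'A. Qed.

(** * Recursion and elementary bounds for [Fn] *)

Section Fn_theory.
Variable R : realType.
Implicit Types (n : nat) (t : nat -> R) (x y z c : R).

Lemma cost1 t : cost 1 t = t 1%N.
Proof. by rewrite /cost big_geq // addr0. Qed.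

Lemma costS n t : cost n.+2 t = cost n.+1 t + t n.+2 / (t n.+1 + 1).
Proof. by rewrite /cost big_nat_recr //= addrA. Qed.

Lemma admissibleS n x t :
  admissible n.+2 x t -> 0 <= t n.+1 /\ admissible n.+1 (t n.+1) t.
Proof.
move=> [t0 _]; split; first by apply: t0; rewrite /= ltnS leqnn.
by split=> // j /andP[j0 jn]; apply: t0; rewrite j0 ltnW.
Qed.

Lemma cost_ge0 n x t : 0 <= x -> admissible n.+1 x t -> 0 <= cost n.+1 t.
Proof.
elim: n x => [|n IH] x x0 at_; first by rewrite cost1 at_.2.
have [tn0 atn] := admissibleS at_.
by rewrite costS addr_ge0 ?(IH _ tn0 atn) // at_.2 divr_ge0 // addr_ge0.
Qed.

Lemma Fn_le_cost n x t : 0 <= x -> admissible n.+1 x t -> Fn n.+1 x <= cost n.+1 t.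
Proof.
move=> x0 at_; apply: ge_inf; last by exists t.
by exists 0 => _ [s as_ <-]; apply: cost_ge0 as_.
Qed.

Lemma le_Fn n x c :
  0 <= x -> (forall t, admissible n.+1 x t -> c <= cost n.+1 t) -> c <= Fn n.+1 x.
Proof.
move=> x0 ct; apply: lb_le_inf; last by move=> _ [t at_ <-]; exact: ct.
by exists (cost n.+1 (fun=> x)); exists (fun=> x).
Qed.

Lemma Fn1 x : 0 <= x -> Fn 1 x = x.
Proof.
move=> x0; apply/le_anti/andP; split.
  by apply: (le_trans (@Fn_le_cost 0 x (fun=> x) x0 _)); rewrite ?cost1.
by apply: le_Fn => // t [_ tx]; rewrite cost1 tx.
Qed.

(** Appending [x] to a chain ending in [y] costs [x / (y + 1)]. Together with [le_FnS] this makes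
    [Fn n.+2 x] the infimum of the right side over [y >= 0]. *)
Lemma FnS_le n x y :
  0 <= x -> 0 <= y -> Fn n.+2 x <= Fn n.+1 y + x / (y + 1).
Proof.
move=> x0 y0; rewrite -lerBlDr; apply: le_Fn => // t [t0 ty].
rewrite lerBlDr; pose s j := if j == n.+2 then x else t j.
have st j : (j < n.+2)%N -> s j = t j by move=> jn; rewrite /s ltn_eqF.
have sx : s n.+2 = x by rewrite /s eqxx.
have as_ : admissible n.+2 x s.
  split=> // j /andP[j0]; rewrite ltnS => jn; rewrite st //.
  by move: jn; rewrite leq_eqVlt => /orP[/eqP->|jn]; [rewrite ty|rewrite t0 ?j0].
apply: le_trans (Fn_le_cost x0 as_) _.
rewrite costS sx st // ty lerD2r /cost st // lerD2l.
rewrite le_eqVlt; apply/orP; left; apply/eqP.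
apply: eq_big_nat => j /andP[j2 jn]; rewrite !st //.
by rewrite (leq_ltn_trans (leq_pred j)).
Qed.

Lemma le_FnS n x c :
  0 <= x -> (forall y, 0 <= y -> c <= Fn n.+1 y + x / (y + 1)) -> c <= Fn n.+2 x.
Proof.
move=> x0 cP; apply: le_Fn => // t at_; have [tn0 atn] := admissibleS at_.
rewrite costS at_.2; apply: le_trans (cP _ tn0) _.
by rewrite lerD2r; apply: Fn_le_cost.
Qed.

Lemma Fn_le n x : 0 <= x -> Fn n.+1 x <= x.
Proof.
elim: n x => [|n IH] x x0; first by rewrite Fn1.
apply: le_trans (FnS_le n x0 (lexx 0)) _.
by rewrite add0r divr1 gerDr IH.
Qed.

Lemma Fn_antitone n x : 0 <= x -> Fn n.+2 x <= Fn n.+1 x.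
Proof.
elim: n x => [|n IH] x x0; first by rewrite (Fn1 x0) Fn_le.
apply: le_FnS => // y y0; apply: le_trans (FnS_le n.+1 x0 y0) _.
by rewrite lerD2r IH.
Qed.

(** For [y > 1] the first summand of the recursion is already at least 1. Otherwise it is at least
    [y], and [y + x / (y + 1)] is at least [x] if [x <= 1], at least 1 if [x > 1]. *)
Lemma Fn_ge_min n x : 0 <= x -> Num.min x 1 <= Fn n.+1 x.
Proof.
elim: n x => [|n IH] x x0; first by rewrite (Fn1 x0) ge_min lexx.
apply: le_FnS => // y y0; have y10 : 0 < y + 1 by lra.
apply: (le_trans _ (lerD (IH y y0) (lexx _))).
have xy0 : 0 <= x / (y + 1) by rewrite divr_ge0 // ltW.
have [y1|y1] := leP y 1; last by rewrite ge_min; apply/orP; right; lra.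
have [x1|x1] := leP x 1.
  rewrite -lerBlDl ler_pdivlMr //.
  nra.
rewrite -lerBlDl ler_pdivlMr //.
nra.
Qed.

Lemma Fn_small n x : 0 <= x <= 1 -> Fn n.+1 x = x.
Proof.
move=> /andP[x0 x1]; apply/le_anti; rewrite Fn_le //=.
by apply: le_trans (Fn_ge_min n x0); rewrite le_min lexx.
Qed.

Lemma Fn_mono n x y : 0 <= x -> x <= y -> Fn n.+1 x <= Fn n.+1 y.
Proof.
move=> x0 xy; have y0 := le_trans x0 xy.
case: n => [|n]; first by rewrite !Fn1.
apply: le_FnS => // z z0; apply: le_trans (FnS_le n x0 z0) _.
by rewrite lerD2l ler_pM2r // invr_gt0; lra.
Qed.

(** The last variable enters with slope 1 or [1 / (z + 1) <= 1], and the infimum keeps this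
    bound. *)
Lemma Fn_lipschitz n x y : 0 <= x -> x <= y -> Fn n.+1 y <= Fn n.+1 x + (y - x).
Proof.
move=> x0 xy; have y0 := le_trans x0 xy.
case: n => [|n]; first by rewrite !Fn1 //; lra.
rewrite -lerBlDr; apply: le_FnS => // z z0; rewrite lerBlDr.
apply: le_trans (FnS_le n y0 z0) _.
rewrite -addrA lerD2l -lerBlDl -mulrBl ler_pdivrMr; last by lra.
by rewrite ler_peMr; lra.
Qed.

(** * Attainment at an interior point *)

(** The constant is 1 from [Fn] plus [x] from the slope of [x / (y + 1)]. *)
Lemma objective_lipschitz n x y z : 0 <= x -> 0 <= y -> y <= z ->
  `|Fn n.+1 y + x / (y + 1) - (Fn n.+1 z + x / (z + 1))| <= (1 + x) * (z - y).
Proof.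
move=> x0 y0 yz; have y10 : 0 < y + 1 by lra.
have z10 : 0 < z + 1 by lra.
have := Fn_mono n y0 yz; have := Fn_lipschitz n y0 yz.
have : 0 <= x / (y + 1) - x / (z + 1) <= x * (z - y).
  have -> : x / (y + 1) - x / (z + 1) = x * (z - y) / ((y + 1) * (z + 1)).
    by field; rewrite !gt_eqF.
  have xzy : 0 <= x * (z - y) by rewrite mulr_ge0 // subr_ge0.
  have yz1 : 1 <= (y + 1) * (z + 1) by nra.
  rewrite divr_ge0 //=; last by rewrite ltW // mulr_gt0.
  by rewrite ler_pdivrMr ?mulr_gt0 // ler_peMr.
move=> /andP[? ?] ? ?; rewrite ler_norml; apply/andP; split; nra.
Qed.

(* The last two terms [y / a + x / (y + 1)] are smallest at
   [y = Num.sqrt (x * a) - 1], which lies below [x - 1] as soon as [a < x]. *)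
Lemma objective_sqrt n x y a c :
  0 <= y -> 1 <= a -> a < x ->
  (forall z, 0 <= z -> Fn n.+1 z <= c + z / a) ->
  exists2 z, 0 < z < x - 1 &
    Fn n.+1 z + x / (z + 1) <= c + y / a + x / (y + 1).
Proof.
move=> y0 a1 ax cP; set s := Num.sqrt (x * a).
have sE : s ^+ 2 = x * a by rewrite sqr_sqrtr // mulr_ge0; lra.
have s0 : 0 <= s by rewrite sqrtr_ge0.
have s1 : 1 < s by rewrite -(ltr_pXn2r (ltn0Sn 1)) ?nnegrE // sE; nra.
have sx : s < x by rewrite -(ltr_pXn2r (ltn0Sn 1)) ?nnegrE ?sE; nra.
exists (s - 1); first by apply/andP; split; lra.
have a0 : 0 < a by lra.
have y10 : 0 < y + 1 by lra.
have s00 : 0 < s by lra.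
have := ler_sqrt_sum a0 y10 s00 sE.
have := cP (s - 1); rewrite subrK mulrBl mulrDl !div1r.
by move=> /(_ ltac:(lra)); lra.
Qed.

(** The case [a = 1], [c = 0]; it serves whenever the value at [y] is [y] itself. *)
Lemma objective_le_id n x y : 1 < x -> 0 <= y ->
  exists2 z, 0 < z < x - 1 & Fn n.+1 z + x / (z + 1) <= y + x / (y + 1).
Proof.
move=> x1 y0; have := @objective_sqrt n x y 1 0 y0 (lexx 1) x1.
by rewrite add0r divr1; apply=> z z0; rewrite add0r divr1 Fn_le.
Qed.

Lemma Fn_attained_of_interior n x : 1 < x ->
  (forall y, 0 <= y -> exists2 z, 0 < z < x - 1 &
     Fn n.+1 z + x / (z + 1) <= Fn n.+1 y + x / (y + 1)) ->
  exists2 y, 0 < y < x - 1 & Fn n.+2 x = Fn n.+1 y + x / (y + 1).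
Proof.
move=> x1 zP; have x0 : 0 <= x by lra.
pose g y := Fn n.+1 y + x / (y + 1).
have [|||c /andP[c0 _] cmin] := @lipschitz_min R g 0 (x - 1) (1 + x); try lra.
  by move=> y z y0 yz _; exact: objective_lipschitz.
(* The minimiser [c] may be an endpoint; the hypothesis trades it for an interior [w] of no larger
   value. *)
have [w wx wc] := zP c c0; exists w => //; move/andP: wx => [w0 wx].
apply/le_anti; rewrite (FnS_le n x0 (ltW w0)) /=; apply: le_FnS => // y y0.
have [z /andP[z0 zx] zy] := zP y y0.
by apply: le_trans zy; apply: le_trans wc (cmin _ _); rewrite !ltW.
Qed.

Lemma Fn_attained n x : 1 < x ->
  exists2 y, 0 < y < x - 1 & Fn n.+2 x = Fn n.+1 y + x / (y + 1).
Proof.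
elim: n x => [|n IH] x x1; apply: Fn_attained_of_interior => // y y0.
  by rewrite (Fn1 y0); exact: objective_le_id.
have [y1|y1] := leP y 1.
  by rewrite (Fn_small n.+1 (_ : 0 <= y <= 1)) ?y0 //; exact: objective_le_id.
(* Since [y > 1], its value unfolds one step further, with [z + 1 < y]. *)
have [z /andP[z0 zy] ->] := IH y y1.
have [zx|xz] := ltP (z + 1) x.
  apply: objective_sqrt => //; first by rewrite lerDr ltW.
  by move=> w w0; apply: FnS_le => //; exact: ltW.
(* Now [x <= z + 1 < y], so shortening the tail [z, y, x] to [z, x] does not raise the cost. The
   point [w] realises [Fn n.+2 x], which is below that cost, and raising the index at [w] only
   lowers the value. *)
have [w /andP[w0 wx] Fw] := IH x x1; exists w; first by rewrite w0.
apply: (@le_trans _ _ (Fn n.+2 x)).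
  by rewrite Fw lerD2r Fn_antitone // ltW.
have [x0 z10 y10] : [/\ 0 <= x, 0 < z + 1 & 0 < y + 1] by split; lra.
apply: le_trans (FnS_le n x0 (ltW z0)) _.
apply: (@le_trans _ _ (Fn n.+1 z + y / (z + 1))); last first.
  by rewrite lerDl divr_ge0 // ltW.
by rewrite lerD2l ler_pM2r ?invr_gt0 //; lra.
Qed.

Lemma Fn_is_min n x : 1 < x -> is_min (step_values (Fn n.+1) x) (Fn n.+2 x).
Proof.
move=> x1; have [y yx yE] := Fn_attained n x1; split; first by exists y.
by move=> _ [z /andP[z0 _] <-]; apply: FnS_le; rewrite ltW //; lra.
Qed.

End Fn_theory.

(** * Uniqueness and comparison of the recursive functions *)

Lemma is_tildeFn_Fn (R : realType) : is_tildeFn (@Fn R).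
Proof.
split=> [[|n] x // _ /andP[x0 x1]|x x0|[|[|n]] x // _ x1].
- by rewrite Fn_small // ltW.
- by rewrite Fn1 // ltW.
- exact: Fn_is_min.
Qed.

Lemma eq_step_values (R : realType) (f g : R -> R) (x : R) :
  (forall y, 0 < y < x - 1 -> f y = g y) -> step_values f x = step_values g x.
Proof.
by move=> fg; apply/seteqP; split=> _ [y yx <-]; exists y; rewrite // fg.
Qed.

Lemma tildeFn_unique (R : realType) (G G' : nat -> R -> R) :
  is_tildeFn G -> is_tildeFn G' ->
  forall (n : nat) (x : R), (1 <= n)%N -> 0 < x -> G n x = G' n x.
Proof.
move=> [Gs G1 GS] [Gs' G1' GS']; elim=> // -[_|n IH] x _ x0.
  by rewrite G1 // G1'.
have [x1|x1] := leP x 1; first by rewrite Gs ?Gs' ?x0.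
apply: is_min_unique (GS n.+2 x isT x1) _.
rewrite (@eq_step_values _ _ (G' n.+1)); first exact: (GS' n.+2).
by move=> y /andP[y0 _]; rewrite IH.
Qed.

Lemma tildeF_is_min (R : realType) (H : R -> R) (x : R) :
  is_tildeF H -> 1 < x -> is_min (step_values H x) (H x).
Proof.
move=> [_ HS] x1.
have xN : exists n, x <= n%:R.
  by exists (Num.truncn x).+1; rewrite ltW // truncnS_gt.
(* The least natural number above or equal to [x] is at least 2; written [k.+2], it places [x] in
   [(k + 1, k + 2]]. *)
case: (ex_minnP xN) => -[|[|k]] xk kmin; try lra.
apply: HS (ltn0Sn k) _; rewrite xk andbT ltNge.
by apply/negP => /kmin; rewrite ltnn.
Qed.

(** Both recursions look only at [y < x - 1], so [x <= n + 1] forces [y <= n] and induction on [n]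
    applies. *)
Lemma tildeF_tildeFn (R : realType) (H : R -> R) (G : nat -> R -> R) :
  is_tildeF H -> is_tildeFn G ->
  forall (n : nat) (x : R), (1 <= n)%N -> 0 < x <= n%:R -> H x = G n x.
Proof.
move=> HH [Gs G1 GS]; elim=> // n IH x _ /andP[x0 xn].
have [x1|x1] := leP x 1; first by rewrite Gs ?HH.1 ?x0.
case: n => [|n] in IH xn *; first by lra.
apply: is_min_unique (tildeF_is_min HH x1) _.
rewrite (@eq_step_values _ _ (G n.+1)); first exact: (GS n.+2).
move=> y /andP[y0 yx]; apply: IH => //.
rewrite y0 /= ltW // (lt_le_trans yx) // lerBlDr.
by rewrite natr1.
Qed.

(** * Stabilisation in [n] and the infimum [Finf] *)

Lemma Fn_stable (R : realType) (n m : nat) (x : R) :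
  0 < x <= n.+1%:R -> (n <= m)%N -> Fn m.+1 x = Fn n.+1 x.
Proof.
elim: n m x => [|n IH] m x /andP[x0 xn].
  by rewrite !Fn_small // ltW.
case: m => // m nm; have [x1|x1] := leP x 1; first by rewrite !Fn_small // ltW.
apply: is_min_unique (Fn_is_min m x1) _.
rewrite (@eq_step_values _ _ (Fn n.+1)); first exact: Fn_is_min.
move=> y /andP[y0 yx]; apply: IH => //.
by rewrite y0 /= ltW // (lt_le_trans yx) // lerBlDr natr1.
Qed.

(** The index exceeds [x], so it lies in the range where the value no longer depends on the
    index. *)
Lemma is_tildeF_Fn_truncn (R : realType) :
  is_tildeF (fun x : R => Fn (Num.truncn x).+1 x).
Proof.
split=> [x /andP[x0 x1]|k x k1 /andP[kx xk]]; first by rewrite Fn_small // ltW.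
have x1 : 1 < x by apply: le_lt_trans kx; rewrite ler1n.
have x0 : 0 < x by lra.
have := truncnS_gt x; set m := Num.truncn x => xm.
have m1 : (0 < m)%N.
  by rewrite -ltnS -(ltr_nat R); lra.
case: k => // k in k1 kx xk *.
(* Raising the index to [m.+2] keeps the value and exposes one step of the recursion over
   [Fn m.+1]. *)
rewrite -(@Fn_stable _ m m.+1 x) ?x0 ?ltW //.
rewrite (@eq_step_values _ _ (Fn m.+1)); first exact: Fn_is_min.
move=> y /andP[y0 yx]; rewrite -(@Fn_stable _ (Num.truncn y) m) //.
  by rewrite y0 ltW // truncnS_gt.
by rewrite truncn_le_nat; lra.
Qed.

Lemma Finf_eq (R : realType) (n : nat) (x : R) :
  0 < x <= n.+1%:R -> Finf x = Fn n.+1 x.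
Proof.
move=> xn; have x0 : 0 <= x by case/andP: xn => /ltW.
have lbF : lbound [set Fn k x | k in [set k | (1 <= k)%N]] (Fn n.+1 x).
  (* At index [(maxn k n).+1] the value equals [Fn n.+1 x] by stability and is at most [Fn k.+1 x]
     by antitonicity. *)
  move=> _ [[//|k] _ <-]; rewrite -(Fn_stable xn (leq_maxr k n)).
  elim: (maxn k n) (leq_maxl k n) => [|m IH]; first by rewrite leqn0 => /eqP->.
  rewrite leq_eqVlt => /orP[/eqP->//|]; rewrite ltnS => /IH.
  exact: le_trans (Fn_antitone _ x0).
apply/le_anti/andP; split.
  by apply: ge_inf; [exists (Fn n.+1 x) | exists n.+1].
by apply: lb_le_inf => //; exists (Fn n.+1 x); exists n.+1.
Qed.

Theorem proposition2p3 (R : realType) :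
  [/\ exists G : nat -> R -> R, is_tildeFn G,
      exists H : R -> R, is_tildeF H &
      forall (G : nat -> R -> R) (H : R -> R),
        is_tildeFn G -> is_tildeF H ->
        [/\ forall (n : nat) (x : R), (1 <= n)%N -> 0 < x <= n%:R -> H x = G n x,
            forall (n : nat) (x : R), (1 <= n)%N -> 0 < x -> G n x = Fn n x &
            forall x : R, 0 < x -> H x = Finf x]].
Proof.
have FF := is_tildeFn_Fn R.
split; first by exists (@Fn R).
  by exists (fun x : R => Fn (Num.truncn x).+1 x); exact: is_tildeF_Fn_truncn.
move=> G H GG HH; split; first exact: tildeF_tildeFn.
  exact: tildeFn_unique.
move=> x x0; have xn : 0 < x <= (Num.truncn x).+1%:R.
  by rewrite x0 ltW // truncnS_gt.
by rewrite (Finf_eq xn); exact: tildeF_tildeFn HH FF _ _ _ xn.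
Qed.
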